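(* Let $p',q'$ be positive integers and put $n=p'+q'-1$. Define the map $g$ on $[0,n-1]=\{c\in\mathbb{Z}: 0\le c\le n-1\}$ by $$g(i)=\begin{cases} i+p' & \text{if } i\in[0,q'-2],\\ i+p'-q' & \text{if } i=q'-1,\\ i-q' & \text{if } i\in[q',n-1].\end{cases}$$ Then $g$ is a permutation of $[0,n-1]$, and, with $\lambda=\gcd(p',q')$, $g$ has exactly $\lambda$ orbits. More precisely, for every $i\in[0,n-1]$ the orbit of $i$ under $g$ equals $\{j\in[0,n-1] : j\equiv i \pmod{\lambda}\}$.
   Context: For integers $a\le b$, $[a,b]$ denotes $\{c\in\mathbb{Z}: a\le c\le b\}$. *)

(* Defs.v *)
From mathcomp Require Import all_boot all_fingroup.

Set Implicit Arguments.
Unset Strict Implicit.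
Unset Printing Implicit Defensive.

(* The guards i.+1 < q and i.+1 == q stand for i <= q - 2 and i = q - 1, so
   that the first range is empty when q = 1. The subtractions are never truncated
   when p > 0: if i = q - 1 then i + p - q = p - 1, and the last branch is only
   reached when q <= i. *)
Definition g (p q i : nat) : nat :=
  if i.+1 < q then i + p
  else if i.+1 == q then i + p - q
  else i - q.

(* Main.v *)
Require Import Defs.
From mathcomp Require Import all_boot all_fingroup.
From mathcomp Require Import zify.

(** The rotation [R : i |-> i + p] of [Z/(p+q)] sends only [q - 1] to the top
    point [p + q - 1], and sends the top point to [p - 1]. Hence [g] is the
    first-return map of [R] on the complement of the top point, and its orbits
    are the traces of the [R]-orbits, i.e. of the residue classes modulo
    [gcd(p, p + q) = gcd(p, q)]. *)

Lemma g_lt (p q i : nat) : 0 < p -> 0 < q -> i < p + q - 1 -> g p q i < p + q - 1.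
Proof. by rewrite /g => hp hq hi; case: ifP => ?; [lia | case: ifP => ?; lia]. Qed.

Lemma g_inj (p q i j : nat) : 0 < p -> 0 < q ->
  i < p + q - 1 -> j < p + q - 1 -> g p q i = g p q j -> i = j.
Proof.
rewrite /g => hp hq hi hj.
by case: ifP => ?; [|case: ifP => ?]; case: ifP => ?; try (case: ifP => ?); lia.
Qed.

Lemma g_modn_gcdn (p q i : nat) : 0 < p -> g p q i = i %[mod gcdn p q].
Proof.
move=> hp; rewrite /g; case: ifP => [_|h1].
  by rewrite -modnDmr (eqP (dvdn_gcdl p q)) addn0.
case: ifP => [h2|h2].
  have hq : q <= i + p by lia.
  (* Modulo the gcd the added [0] may be replaced by [q], which cancels the subtraction. *)
  rewrite -[i + p - q in LHS]addn0 -(eqP (dvdn_gcdr p q)) modnDmr subnK //.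
  by rewrite -modnDmr (eqP (dvdn_gcdl p q)) addn0.
have hq : q <= i by lia.
by rewrite -{2}(subnK hq) -[RHS]modnDmr (eqP (dvdn_gcdr p q)) addn0.
Qed.

(** By Bezout, some [a] satisfies [a * p = gcdn p q] modulo [p + q], so [a] rotation steps advance a
    point by exactly the gcd. *)
Lemma rotation_transitive (p q i j : nat) : 0 < p -> j < p + q ->
  j = i %[mod gcdn p q] -> exists k, (i + k * p) %% (p + q) = j.
Proof.
move=> hp hj eij.
have dN : gcdn p q %| p + q by rewrite dvdn_add ?dvdn_gcdl ?dvdn_gcdr.
case: (egcdnP (p + q) hp) => a b; rewrite gcdnDl => eab _.
(* The term [i * (p + q - 1)] plays the part of [- i] modulo [p + q], so [t] counts the advances by
   the gcd from [i] to [j] without truncated subtraction. *)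
have /dvdnP[t et] : gcdn p q %| j + i * (p + q - 1).
  rewrite /dvdn -modnDml eij modnDml -mulnS.
  have -> : (p + q - 1).+1 = p + q by clear -hp; lia.
  exact: dvdn_mull.
exists (t * a).
have -> : i + t * a * p = (t * b + i) * (p + q) + j.
  rewrite -mulnA eab mulnDr -et mulnDl -mulnA addnCA -addnA; congr (_ + _).
  have {2}-> : p + q = (p + q - 1).+1 by clear -hp; lia.
  by rewrite mulnS; clear; lia.
by rewrite modnMDl modn_small.
Qed.

Section Orbits.

Variables (p q : nat) (s : {perm 'I_(p + q - 1)}).
Hypotheses (hp : 0 < p) (hq : 0 < q).
Hypothesis sE : forall i : 'I_(p + q - 1), s i = g p q i :> nat.

(** Strong induction on the number of rotation steps: one application of [s] uses up one step, or
    two when the path crosses the top point. *)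
Lemma rotation_porbit (k : nat) (i j : 'I_(p + q - 1)) :
  (i + k * p) %% (p + q) = j -> j \in porbit s i.
Proof.
have [m] := ubnP k; elim: m k i j => // m IH [|k] i j hk.
  have ? := ltn_ord i.
  rewrite mul0n addn0 modn_small; last by lia.
  by move/val_inj=> <-; exact: porbit_id.
have step k' : k' < m -> (s i + k' * p) %% (p + q) = j -> j \in porbit s i.
  by move=> hk' /(IH _ _ _ hk'); rewrite -(porbit_perm s 1 i) expg1.
have [hi hj] := (ltn_ord i, ltn_ord j).
move=> hR; have [h1|h1|h1] := ltngtP i.+1 q.
- by apply: (step k); rewrite ?sE /g ?h1 //; rewrite -hR; congr (_ %% _); lia.
- apply: (step k); rewrite ?sE /g //.
  have -> : (i.+1 < q) = false by lia.
  have -> : (i.+1 == q) = false by lia.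
  (* The rotation wraps around here: [i - q] is [i + p] less one full turn. *)
  by rewrite -hR -[LHS]modnDr; congr (_ %% _); lia.
(* Now [i = q - 1]. A single step would end at the top point, which [j] is not, so at least two
   steps remain. *)
- case: k hk hR => [|k] hk hR.
    by rewrite mul1n modn_small in hR; lia.
  apply: (step k); first lia.
  rewrite sE /g h1 ltnn eqxx -hR -[LHS]modnDr; congr (_ %% _); lia.
Qed.

Lemma porbit_residue (i : 'I_(p + q - 1)) :
  porbit s i = [set j : 'I_(p + q - 1) | j == i %[mod gcdn p q]].
Proof.
apply/setP => j; rewrite inE; apply/idP/eqP => [/porbitP[k ->]|eij].
  elim: k => [|k IH]; first by rewrite expg0 perm1.
  by rewrite expgSr permM sE g_modn_gcdn.
have hj : j < p + q by have := ltn_ord j; lia.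
by have [k /rotation_porbit] := rotation_transitive p q i j hp hj eij.
Qed.

Lemma card_porbits_residue : #|porbits s| = gcdn p q.
Proof.
set d := gcdn p q.
have d0 : 0 < d by rewrite gcdn_gt0 hp.
(* Since [d <= p <= p + q - 1], the points below [d] exist and represent every residue once. *)
have dn : d <= p + q - 1 by have := dvdn_leq hp (dvdn_gcdl p q); rewrite -/d; lia.
pose f (r : 'I_d) := porbit s (widen_ord dn r).
have f_inj : injective f.
  move=> r r' /eqP; rewrite eq_porbit_mem porbit_residue inE /= -/d.
  by rewrite !modn_small // => /eqP/val_inj.
rewrite -[RHS]card_ord -(card_imset predT f_inj).
apply: eq_card => A; apply/imsetP/imsetP => [[i _ ->]|[r _ ->]]; last by exists (widen_ord dn r).
exists (Ordinal (ltn_pmod i d0)) => //.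
by apply/eqP; rewrite eq_porbit_mem porbit_residue inE /= -/d modn_mod.
Qed.

End Orbits.

Theorem theorem2p2 (p q : nat) (hp : 0 < p) (hq : 0 < q) :
  exists s : {perm 'I_(p + q - 1)},
    [/\ forall i : 'I_(p + q - 1), s i = g p q i :> nat,
        #|porbits s| = gcdn p q
      & forall i : 'I_(p + q - 1),
          porbit s i = [set j : 'I_(p + q - 1) | j == i %[mod gcdn p q]]].
Proof.
pose f (i : 'I_(p + q - 1)) := Ordinal (g_lt p q i hp hq (ltn_ord i)).
have f_inj : injective f.
  by move=> i j [] /(g_inj p q i j hp hq (ltn_ord i) (ltn_ord j)) /val_inj.
have sE (i : 'I_(p + q - 1)) : perm f_inj i = g p q i :> nat by rewrite permE.
exists (perm f_inj); split=> //; first exact: card_porbits_residue.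
by move=> i; exact: porbit_residue.
Qed.
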